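(* Let $F$ be a field of characteristic zero, $G$ a finite group, and let $A$ be a unitary $(G,* )$-algebra over $F$ with quadratic codimension growth and of type $F+J(A)$. For $g,h\in G$ with $h\neq 1$: (1) $m_{((1)_{h^+})}\neq 0$ if and only if $C_2^h\in\mathrm{var}^\sharp(A)$. (2) $m_{((1)_{g^-})}\neq 0$ if and only if $C_{2,*}^g\in\mathrm{var}^\sharp(A)$.
   Context: A $(G,* )$-algebra is an associative $G$-graded $F$-algebra $A=\bigoplus_{g\in G}A_g$ with an ($F$-linear) involution $*$ such that $A_g^*=A_g$; put $A_g^{\pm}=\{a\in A_g:a^*=\pm a\}$. Unitary means having a unit element; type $F+J(A)$ means $A=F\cdot 1+J(A)$ with $J(A)$ the Jacobson radical. The free $(G,* )$-algebra is the free associative algebra on variables $x_{i,g}^+$ (symmetric of degree $g$) and $x_{i,g}^-$ (skew of degree $g$), $i\ge1$, $g\in G$. $\mathrm{Id}^\sharp(A)$ is the set of its elements vanishing under all evaluations $x_{i,g}^\epsilon\mapsto a\in A_g^\epsilon$; $\mathrm{var}^\sharp(A)$ is the class of all $(G,* )$-algebras $B$ with $\mathrm{Id}^\sharp(A)\subseteq\mathrm{Id}^\sharp(B)$. $P_n^\sharp$ is the span of all $w_{\sigma(1)}\cdots w_{\sigma(n)}$, $\sigma\in S_n$, $w_i\in\{x_{i,g}^\pm:g\in G\}$; $c_n^\sharp(A)=\dim_FP_n^\sharp/(P_n^\sharp\cap\mathrm{Id}^\sharp(A))$; quadratic codimension growth means $c_n^\sharp(A)=qn^2+\mathcal{O}(n)$,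 $q>0$. A proper polynomial is a linear combination of products of variables and commutators of variables in which variables $x_{i,1}^+$ occur only inside commutators. For $s\in G$, $\epsilon\in\{+,-\}$, $s^\epsilon\ne1^+$, $\Gamma_{(1_{s^\epsilon})}=\mathrm{span}_F\{x_{1,s}^\epsilon\}$ is the space of multilinear proper polynomials in one variable $x_{1,s}^\epsilon$, and $m_{((1)_{s^\epsilon})}$ is the multiplicity of the trivial character of $S_1$ in the quotient $\Gamma_{(1_{s^\epsilon})}/(\Gamma_{(1_{s^\epsilon})}\cap\mathrm{Id}^\sharp(A))$. $C_2=\mathrm{span}_F\{I_2,e_{12}\}\subset UT_2(F)$. For $g\in G$ grade it with $I_2$ in degree $1$ and $e_{12}$ in degree $g$. $C_2^g$ is this graded algebra with trivial involution; $C_{2,*}^g$ is this graded algebra with involution $I_2\mapsto I_2$, $e_{12}\mapsto -e_{12}$. *)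

(* Defs.v *)
From HB Require Import structures.
From mathcomp Require Import all_boot all_algebra all_fingroup.
From mathcomp Require Import mxrepresentation.
From mathcomp Require Import boolp classical_sets reals topology normedtype landau.
From mathcomp Require monalg.
Import (canonicals, coercions) monalg.

Set Implicit Arguments.
Unset Strict Implicit.
Unset Printing Implicit Defensive.

Import GRing.Theory Num.Theory.

Local Open Scope classical_set_scope.
Local Open Scope ring_scope.

Section LinearAlgebra.
Variables (F : fieldType) (L : lmodType F).

Definition is_subspace (V : set L) : Prop :=
  V 0 /\ forall c u v, V u -> V v -> V (c *: u + v).

Definition lin_span (X : set L) : set L :=
  [set v | exists (k : nat) (c : 'I_k -> F) (x : 'I_k -> L),
     (forall i, X (x i)) /\ v = \sum_i c i *: x i].

(* For W contained in V: the classes of the b i form a basis of V / W. *)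
Definition quotient_basis (V W : set L) (d : nat) (b : 'I_d -> L) : Prop :=
  [/\ forall i, V (b i),
      forall c : 'I_d -> F, W (\sum_i c i *: b i) -> forall i, c i = 0 &
      forall v, V v -> exists c : 'I_d -> F, W (v - \sum_i c i *: b i)].

(* The default 0 is only used when V / W is not finite dimensional. *)
Definition quotient_dim (V W : set L) : nat :=
  xget 0%N [set d | exists b : 'I_d -> L, quotient_basis V W b].

End LinearAlgebra.

Section Jacobson.
Variable (R : nzRingType).

Definition left_ideal (I : set R) : Prop :=
  [/\ I 0, forall a b, I a -> I b -> I (a + b) & forall r a, I a -> I (r * a)].

Definition maximal_left_ideal (I : set R) : Prop :=
  [/\ left_ideal I, I <> setT &
      forall K : set R, left_ideal K -> I `<=` K -> K = I \/ K = setT].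

Definition jacobson_radical : set R :=
  [set a | forall I : set R, maximal_left_ideal I -> I a].

End Jacobson.

(* Unitary (G,* )-algebras over F, where G is the whole of gT. *)
Record gstar_algebra (F : fieldType) (gT : finGroupType) := GStarAlgebra {
  carrier :> algType F;
  homog : gT -> set carrier;
  star : carrier -> carrier;
  homog_subspace : forall g, is_subspace (homog g);
  homogM : forall g h a b,
    homog g a -> homog h b -> homog (g * h)%g (a * b);
  homog_total : forall a, exists2 f : gT -> carrier,
    forall g, homog g (f g) & a = \sum_g f g;
  homog_direct : forall f : gT -> carrier,
    (forall g, homog g (f g)) -> \sum_g f g = 0 -> forall g, f g = 0;
  star_linear : forall c a b, star (c *: a + b) = c *: star a + star b;
  starM : forall a b, star (a * b) = star b * star a;
  starK : involutive star;
  star_homog : forall g, star @` homog g = homog g }.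

Section FreeAlgebra.
Variables (F : fieldType) (gT : finGroupType).

(* (i, g, false) is the symmetric variable x_{i+1,g}^+ and (i, g, true) the
   skew variable x_{i+1,g}^-: indices start at 0, signs are booleans e read
   as (-1)^e. *)
Definition gvar : choiceType := (nat * gT * bool)%type.

Definition free_gstar : lalgType F := monalg.malg (monalg.fmonom gvar) F.

Definition fvar (x : gvar) : free_gstar := monalg.mkmalgU (monalg.fmu x) 1.

(* The unital F-algebra morphism sending each variable x to phi x. *)
Definition feval (B : lalgType F) (phi : gvar -> B) (p : free_gstar) : B :=
  monalg.mmap (in_alg B) (fun m : monalg.fmonom gvar => \prod_(x <- (m : seq gvar)) phi x) p.

(* A_g^+ for e = false, A_g^- for e = true *)
Definition homog_sgn (A : gstar_algebra F gT) (g : gT) (e : bool) : set A :=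
  [set a | homog g a /\ star a = (-1) ^+ e * a].

Definition Id_sharp (A : gstar_algebra F gT) : set free_gstar :=
  [set p | forall phi : gvar -> A,
     (forall i g e, homog_sgn g e (phi (i, g, e))) -> feval phi p = 0].

(* The unitary members of the variety generated by A. *)
Definition var_sharp (A B : gstar_algebra F gT) : Prop :=
  Id_sharp A `<=` Id_sharp B.

Definition P_sharp (n : nat) : set free_gstar :=
  lin_span [set p | exists (s : 'S_n) (w : 'I_n -> gT * bool),
    p = \prod_(i < n) fvar (val (s i), (w (s i)).1, (w (s i)).2)].

Definition codim_sharp (A : gstar_algebra F gT) (n : nat) : nat :=
  quotient_dim (P_sharp n) (P_sharp n `&` Id_sharp A).

Definition quadratic_growth (R : realType) (A : gstar_algebra F gT) : Prop :=
  exists2 q : R, 0 < q &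
    (fun n : nat => (codim_sharp A n)%:R - q * n%:R ^+ 2 : R^o)
      =O_\oo (fun n : nat => n%:R : R^o).

Definition type_F_plus_J (A : gstar_algebra F gT) : Prop :=
  forall a : A, exists (c : F) (j : A), jacobson_radical j /\ a = c%:A + j.

(* Multilinear proper polynomials in the single variable x_{1,s}^e,
   for s^e <> 1^+. *)
Definition Gamma1 (s : gT) (e : bool) : set free_gstar :=
  lin_span [set fvar (0%N, s, e)].

(* The action of a permutation of the first n variable indices. *)
Definition rename (n : nat) (t : 'S_n) : free_gstar -> free_gstar :=
  feval (fun x : gvar =>
    fvar (if insub x.1.1 is Some i then val (t i) else x.1.1, x.1.2, x.2)).

(* m is the coefficient of chi_(1), the constant function 1, in the
   decomposition of the character of the S_1-module Gamma1 / (Gamma1 cap Id)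
   into irreducible characters; chi_(1) is the only irreducible character
   of S_1. *)
Definition is_mult1 (A : gstar_algebra F gT) (s : gT) (e : bool) (m : nat) :
    Prop :=
  exists (d : nat) (b : 'I_d -> free_gstar)
         (rG : mx_representation F [set: 'S_1]%G d),
    let W := Gamma1 s e `&` Id_sharp A in
    [/\ quotient_basis (Gamma1 s e) W b,
        forall t i, W (rename t (b i) - \sum_j rG t i j *: b j) &
        forall t : 'S_1, \tr (rG t) = m%:R * 1].

(* The default 0 is never used: such an m always exists. *)
Definition mult1 (A : gstar_algebra F gT) (s : gT) (e : bool) : nat :=
  xget 0%N [set m | is_mult1 A s e m].

End FreeAlgebra.

Section C2.
Variable (F : fieldType).

Definition e12 : 'M[F]_2 := delta_mx 0 1.

Definition C2_space : {vspace 'M[F]_2} := <<[:: 1; e12]>>%VS.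

Definition in_C2 : pred 'M[F]_2 := fun M => M \in C2_space.

Lemma in_C2P (M : 'M[F]_2) :
  reflect (exists u : F * F, M = u.1%:M + u.2 *: e12) (M \in C2_space).
Proof.
rewrite /C2_space span_cons span_seq1; apply: (iffP memv_addP).
  case=> _ /vlineP[a ->] [_ /vlineP[b ->] ->]; exists (a, b) => /=.
  by rewrite scalemx1.
case=> -[a b] /= ->; exists a%:M; first by rewrite -scalemx1 memvZ ?memv_line.
by exists (b *: e12); rewrite ?memvZ ?memv_line.
Qed.

Lemma e12_sqr : e12 * e12 = 0.
Proof. by rewrite /e12 -mulmxE mul_delta_mx_0. Qed.

Lemma C2_mul (a b c d : F) : (a%:M + b *: e12) * (c%:M + d *: e12)
  = (a * c)%:M + (a * d + b * c) *: e12.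
Proof.
rewrite -mulmxE mulmxDl !mulmxDr !mul_scalar_mx !mul_mx_scalar.
have -> : (b *: e12) *m (d *: e12) = 0.
  by rewrite -scalemxAl -scalemxAr mulmxE e12_sqr !scaler0.
by rewrite addr0 scale_scalar_mx !scalerA -addrA -scalerDl [c * b]mulrC.
Qed.

Fact in_C2_subalg : GRing.subalg_closed in_C2.
Proof.
split; first by apply/in_C2P; exists (1, 0); rewrite /= scale0r addr0.
  by move=> c u v uC vC; apply: memvD => //; apply: memvZ.
move=> _ _ /in_C2P[[a b] /= ->] /in_C2P[[c d] /= ->]; apply/in_C2P.
by exists (a * c, a * d + b * c); rewrite C2_mul.
Qed.

HB.instance Definition _ := GRing.isSubalgClosed.Build F 'M[F]_2 in_C2 in_C2_subalg.

Definition C2_alg := {M : 'M[F]_2 | in_C2 M}.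

HB.instance Definition _ := SubType.on C2_alg.
HB.instance Definition _ := Choice.on C2_alg.
HB.instance Definition _ := [SubChoice_isSubAlgebra of C2_alg by <:].

Fact C2_mk_subproof (a b : F) : in_C2 (a%:M + b *: e12).
Proof. by apply/in_C2P; exists (a, b). Qed.

Definition C2_mk (a b : F) : C2_alg := Sub (a%:M + b *: e12) (C2_mk_subproof a b).

Definition C2_skew (M : C2_alg) : C2_alg := C2_mk (val M 0 0) (- val M 0 1).

Lemma C2_mk00 a b : val (C2_mk a b) 0 0 = a.
Proof. by rewrite /= !mxE /= mulr0 addr0. Qed.

Lemma C2_mk01 a b : val (C2_mk a b) 0 1 = b.
Proof. by rewrite /= !mxE /= mulr1 add0r. Qed.

Lemma C2_mkP (M : C2_alg) : {u : F * F | M = C2_mk u.1 u.2}.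
Proof.
exists (val M 0 0, val M 0 1); apply: val_inj => /=.
have /in_C2P[[a b] /= ->] := valP M.
by rewrite -/(val (C2_mk a b)) C2_mk00 C2_mk01.
Qed.

Lemma C2_skew_mk a b : C2_skew (C2_mk a b) = C2_mk a (- b).
Proof. by rewrite /C2_skew C2_mk00 C2_mk01. Qed.

Lemma C2_mkD a b c d : C2_mk a b + C2_mk c d = C2_mk (a + c) (b + d).
Proof.
by apply: val_inj; rewrite /= raddfD /= scalerDl addrACA.
Qed.

Lemma C2_mkZ c a b : c *: C2_mk a b = C2_mk (c * a) (c * b).
Proof. by apply: val_inj; rewrite /= scalerDr scale_scalar_mx scalerA. Qed.

Lemma C2_mkM a b c d : C2_mk a b * C2_mk c d = C2_mk (a * c) (a * d + b * c).
Proof. by apply: val_inj; rewrite /= C2_mul. Qed.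

Lemma C2_mk0 : 0 = C2_mk 0 0.
Proof. by apply: val_inj; rewrite /= scale0r addr0 raddf0. Qed.

Lemma C2_mk1 : 1 = C2_mk 1 0.
Proof. by apply: val_inj; rewrite /= scale0r addr0. Qed.

Lemma C2_mk_inj a b c d : C2_mk a b = C2_mk c d -> a = c /\ b = d.
Proof.
by move=> E; rewrite -{1}(C2_mk00 a b) -{2}(C2_mk01 a b) E C2_mk00 C2_mk01.
Qed.

Variables (gT : finGroupType) (g : gT).

(* I_2 in degree 1 and e12 in degree g; both in degree 1 when g = 1. *)
Definition C2_homog (k : gT) : set C2_alg :=
  [set M | val M \in ((if k == 1%g then <[1 : 'M[F]_2]> else 0)
                      + (if k == g then <[e12]> else 0))%VS].

Lemma C2_homogP k a b :
  C2_homog k (C2_mk a b) <-> (k != 1%g -> a = 0) /\ (k != g -> b = 0).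
Proof.
split=> [/memv_addP[u u1 [v v1]] | [a0 b0]] /=.
  have [c [-> c0]] : exists c, u = c%:M /\ (k != 1%g -> c = 0).
    case: eqP u1 => [_ /vlineP[c ->]|_]; first by exists c; rewrite scalemx1.
    by rewrite memv0 => /eqP ->; exists 0; rewrite raddf0.
  have [d [-> d0]] : exists d, v = d *: e12 /\ (k != g -> d = 0).
    case: eqP v1 => [_ /vlineP[d ->]|_]; first by exists d.
    by rewrite memv0 => /eqP ->; exists 0; rewrite scale0r.
  by move=> E; have /C2_mk_inj[-> ->] : C2_mk a b = C2_mk c d by apply: val_inj.
apply: memv_add.
  have [_|/a0 ->] := eqVneq k 1%g; last by rewrite raddf0 mem0v.
  by rewrite -scalemx1 memvZ ?memv_line.
have [_|/b0 ->] := eqVneq k g; last by rewrite scale0r mem0v.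
by rewrite memvZ ?memv_line.
Qed.

Definition C2_star (e : bool) (M : C2_alg) : C2_alg :=
  if e then C2_skew M else M.

Lemma C2_star_mk e a b : C2_star e (C2_mk a b) = C2_mk a ((-1) ^+ e * b).
Proof. by case: e; rewrite /C2_star ?C2_skew_mk ?mulN1r ?mul1r. Qed.

Fact C2_homog_subspace k : is_subspace (C2_homog k).
Proof.
split; first by rewrite C2_mk0; apply/C2_homogP.
move=> c u v; have [[a b] /= ->] := C2_mkP u; have [[a' b'] /= ->] := C2_mkP v.
move=> /C2_homogP[a0 b0] /C2_homogP[a'0 b'0]; rewrite C2_mkZ C2_mkD.
apply/C2_homogP; split=> kN.
  by rewrite (a0 kN) (a'0 kN) mulr0 addr0.
by rewrite (b0 kN) (b'0 kN) mulr0 addr0.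
Qed.

Fact C2_homogM k l u v :
  C2_homog k u -> C2_homog l v -> C2_homog (k * l)%g (u * v).
Proof.
have [[a b] /= ->] := C2_mkP u; have [[a' b'] /= ->] := C2_mkP v.
move=> /C2_homogP[a0 b0] /C2_homogP[a'0 b'0]; rewrite C2_mkM.
apply/C2_homogP; split.
  have [k1|/a0->] := eqVneq k 1%g; last by rewrite mul0r.
  by have [l1|/a'0->] := eqVneq l 1%g; rewrite ?mulr0 // k1 l1 mulg1 eqxx.
move=> klN; have -> : b * a' = 0.
  have [kg|/b0->] := eqVneq k g; last by rewrite mul0r.
  have [l1|/a'0->] := eqVneq l 1%g; last by rewrite mulr0.
  by rewrite kg l1 mulg1 eqxx in klN.
rewrite addr0; have [k1|/a0->] := eqVneq k 1%g; last by rewrite mul0r.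
have [lg|/b'0->] := eqVneq l g; last by rewrite mulr0.
by rewrite k1 lg mul1g eqxx in klN.
Qed.

Lemma C2_mk_sum (I : finType) (a b : I -> F) :
  \sum_i C2_mk (a i) (b i) = C2_mk (\sum_i a i) (\sum_i b i).
Proof.
by elim/big_rec3: _ => [|i x y _ _ ->]; rewrite ?C2_mk0 ?C2_mkD.
Qed.

Fact C2_homog_total u :
  exists2 f : gT -> C2_alg, forall k, C2_homog k (f k) & u = \sum_k f k.
Proof.
have [[a b] /= ->] := C2_mkP u.
exists (fun k => C2_mk (if k == 1%g then a else 0) (if k == g then b else 0)).
  by move=> k; apply/C2_homogP; split=> /negPf ->.
by rewrite C2_mk_sum -!big_mkcond !big_pred1_eq.
Qed.

Fact C2_homog_direct (f : gT -> C2_alg) :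
  (forall k, C2_homog k (f k)) -> \sum_k f k = 0 -> forall k, f k = 0.
Proof.
move=> fh; pose a k := val (f k) 0 0; pose b k := val (f k) 0 1.
have fE k : f k = C2_mk (a k) (b k).
  by rewrite /a /b; have [[c d] /= ->] := C2_mkP (f k); rewrite C2_mk00 C2_mk01.
have h k : (k != 1%g -> a k = 0) /\ (k != g -> b k = 0).
  by apply/C2_homogP; rewrite -fE.
rewrite (eq_bigr _ (fun k _ => fE k)) C2_mk_sum C2_mk0 => /C2_mk_inj[].
rewrite (bigD1 1%g) //= big1 ?addr0 => [a1|k /(h k).1 //].
rewrite (bigD1 g) //= big1 ?addr0 => [bg|k /(h k).2 //] k.
rewrite fE; congr C2_mk.
  by have [->|/(h k).1] := eqVneq k 1%g.
by have [->|/(h k).2] := eqVneq k g.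
Qed.

Fact C2_star_linear e c u v :
  C2_star e (c *: u + v) = c *: C2_star e u + C2_star e v.
Proof.
have [[a b] /= ->] := C2_mkP u; have [[a' b'] /= ->] := C2_mkP v.
by rewrite !(C2_mkZ, C2_mkD, C2_star_mk) mulrDr mulrCA.
Qed.

Fact C2_starM e u v : C2_star e (u * v) = C2_star e v * C2_star e u.
Proof.
have [[a b] /= ->] := C2_mkP u; have [[a' b'] /= ->] := C2_mkP v.
rewrite !(C2_mkM, C2_star_mk); congr C2_mk; first by rewrite mulrC.
rewrite mulrDr addrC; congr (_ + _); first by rewrite mulrA mulrC.
by rewrite [a * b']mulrC mulrA.
Qed.

Fact C2_starK e : involutive (C2_star e).
Proof.
move=> u; have [[a b] /= ->] := C2_mkP u.
by rewrite !C2_star_mk mulrA -expr2 sqrr_sign mul1r.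
Qed.

Fact C2_star_homog e k : C2_star e @` C2_homog k = C2_homog k.
Proof.
have H u : C2_homog k u -> C2_homog k (C2_star e u).
  have [[a b] /= ->] := C2_mkP u; rewrite C2_star_mk.
  move=> /C2_homogP[a0 b0]; apply/C2_homogP; split=> // /b0 ->.
  by rewrite mulr0.
apply/seteqP; split=> [_ [u uk <-]|u uk]; first exact: H.
by exists (C2_star e u); [exact: H | exact: C2_starK].
Qed.

Definition C2_gstar (e : bool) : gstar_algebra F gT :=
  GStarAlgebra C2_homog_subspace C2_homogM C2_homog_total C2_homog_direct
    (C2_star_linear e) (C2_starM e) (C2_starK e) (C2_star_homog e).

End C2.

(* C_2^g: trivial involution *)
Definition C2 (F : fieldType) (gT : finGroupType) (g : gT) :
  gstar_algebra F gT := C2_gstar F g false.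

(* C_{2,*}^g: the involution sends e12 to - e12 *)
Definition C2s (F : fieldType) (gT : finGroupType) (g : gT) :
  gstar_algebra F gT := C2_gstar F g true.

(* Main.v *)
(** As [Gamma_(1_{s^e})] is the line spanned by [x = x_{1,s}^e], the
    multiplicity is nonzero iff [x] is not an identity of [A], i.e. iff some
    nonzero [a] lies in [A_s^e].

    An admissible evaluation in [C_2] sends each variable to
    [alpha + beta e12]; it factors through the evaluation in [F[X]] sending the
    same variable to [alpha + beta X].  Let [q] be the value of a polynomial [f]
    there.  Substituting [t a] for [X], with [t] in [F], gives an admissible
    evaluation in [A].  If [f] is an identity of [A], then
    [\sum_k t^k q_k a^k = 0] for all [t], so each [q_k a^k] vanishes by a
    Vandermonde argument.  Thus [q_0 = q_1 = 0], and [q] vanishes at [e12]. *)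
Require Import Defs.
From mathcomp Require Import all_boot all_algebra all_fingroup.
From mathcomp Require Import mxrepresentation boolp classical_sets.
From mathcomp Require Import reals.
From mathcomp Require monalg.

Set Implicit Arguments.
Unset Strict Implicit.
Unset Printing Implicit Defensive.

Import GRing.Theory.
Local Open Scope ring_scope.

(** * Vandermonde argument and linear algebra *)

Lemma sum_exp_scale_eq0 (F : fieldType) (V : lmodType F) (n : nat)
    (c : 'I_n -> V) :
  [pchar F] =i pred0 -> (forall t : F, \sum_(k < n) t ^+ k *: c k = 0) ->
  forall k, c k = 0.
Proof.
move=> /pcharf0P F0 c0 k0.
(* The nodes [0, ..., n-1] stay distinct in [F] by characteristic zero. *)
pose a : 'rV[F]_n := \row_j (j : nat)%:R.
have Mu : Vandermonde n a \in unitmx.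
  rewrite unitmxE unitfE det_Vandermonde.
  apply/prodf_neq0 => i _; apply/prodf_neq0 => j ltij.
  by rewrite !mxE -natrB ?F0 ?subn_eq0 -?ltnNge // ltnW.
have MV := mulmxV Mu; set N := invmx _ in MV.
(* Column [k0] of the inverse [N] recovers [c k0] from the values of the sum at the nodes. *)
have -> : c k0 = \sum_k (Vandermonde n a *m N) k k0 *: c k.
  rewrite MV (bigD1 k0) //= mxE eqxx scale1r big1 ?addr0 // => k /negPf k0N.
  by rewrite mxE k0N scale0r.
transitivity (\sum_j N j k0 *: \sum_(k < n) (j : nat)%:R ^+ k *: c k).
  under [RHS]eq_bigr do rewrite scaler_sumr.
  rewrite exchange_big; apply: eq_bigr => k _ /=.
  rewrite mxE scaler_suml; apply: eq_bigr => j _.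
  by rewrite !mxE scalerA mulrC.
by rewrite big1 // => j _; rewrite c0 scaler0.
Qed.

Lemma quotient_basis_notin (F : fieldType) (L : lmodType F) (V W : set L)
    (d : nat) (b : 'I_d -> L) (i : 'I_d) :
  quotient_basis V W b -> ~ W (b i).
Proof.
case=> _ bfree _ Wbi; have /bfree/(_ i) : W (\sum_j (j == i)%:R *: b j).
  rewrite (bigD1 i) //= eqxx scale1r big1 ?addr0 // => j /negPf ->.
  by rewrite scale0r.
by rewrite eqxx => /eqP; rewrite oner_eq0.
Qed.

Lemma horner_alg_sum (F : fieldType) (B : algType F) (b : B) (q : {poly F}) :
  horner_alg b q = \sum_(i < size q) q`_i *: b ^+ i.
Proof.
rewrite -{1}[q]coefK poly_def linear_sum; apply: eq_bigr => i _.
by rewrite linearZ rmorphXn /= horner_algX mulr_algl.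
Qed.

Lemma horner_alg_scale_eq0 (F : fieldType) (B : algType F) (b : B)
    (q : {poly F}) :
  [pchar F] =i pred0 -> (forall t : F, horner_alg (t *: b) q = 0) ->
  forall i, q`_i *: b ^+ i = 0.
Proof.
move=> F0 q0 i; have [ltiq|/(nth_default 0) ->] := ltnP i (size q); last first.
  by rewrite scale0r.
apply: (@sum_exp_scale_eq0 _ _ _ (fun k : 'I__ => q`_k *: b ^+ k) F0 _
  (Ordinal ltiq)) => t.
rewrite -[RHS](q0 t) horner_alg_sum; apply: eq_bigr => k _.
by rewrite exprZn !scalerA mulrC.
Qed.

Lemma mx_repr1 (F : fieldType) (rT : finGroupType) (H : {group rT}) (n : nat) :
  mx_repr H (fun=> 1%:M : 'M[F]_n).
Proof. by split=> [|x y _ _] /=; rewrite ?mulmx1. Qed.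

(** * Evaluations of the free algebra *)

Section Evaluation.
Variables (F : fieldType) (gT : finGroupType).

Lemma feval_var (B : lalgType F) (phi : gvar gT -> B) x :
  feval phi (fvar F x) = phi x.
Proof.
rewrite /feval /fvar monalg.mmapU /= scale1r mul1r.
by rewrite /monalg.fmu monalg.fmE big_seq1.
Qed.

Lemma fevalP (B : lalgType F) (phi : gvar gT -> B) (c : F)
    (p q : free_gstar F gT) :
  feval phi (c *: p + q) = c *: feval phi p + feval phi q.
Proof.
rewrite /feval monalg.mmapD; congr (_ + _).
(* For [c = 0] the support shrinks, so both sides are summed over the support of [p]. *)
rewrite (monalg.mmapEw (monalg.msuppZ_le _ _)) monalg.mmapE scaler_sumr.
by apply: eq_bigr => k _; rewrite monalg.mcoeffZ /= !mulr_algl scalerA.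
Qed.

Lemma feval_morph (B C : lalgType F) (h : {rmorphism B -> C})
    (phi : gvar gT -> B) (p : free_gstar F gT) :
  (forall c : F, h c%:A = c%:A) -> feval (h \o phi) p = h (feval phi p).
Proof.
move=> hA; rewrite /feval !monalg.mmapE rmorph_sum; apply: eq_bigr => m _.
by rewrite rmorphM rmorph_prod /= hA.
Qed.

(** Lets one evaluation in [{poly F}] serve both [C_2] and [A]: only the element substituted for
    ['X] changes. *)
Lemma feval_horner_alg (B : algType F) (b : B) (psi : gvar gT -> {poly F})
    (p : free_gstar F gT) :
  feval (fun x => horner_alg b (psi x)) p = horner_alg b (feval psi p).
Proof. by apply: feval_morph => c; rewrite alg_polyC /= horner_algC. Qed.

Lemma eq_feval (B : lalgType F) (phi psi : gvar gT -> B) (p : free_gstar F gT) :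
  phi =1 psi -> feval phi p = feval psi p.
Proof. by move=> /funext ->. Qed.

Lemma Id_sharp_subspace (A : gstar_algebra F gT) : is_subspace (Id_sharp A).
Proof.
split=> [phi _|c p q p0 q0 phi phiA]; first by rewrite /feval monalg.mmap0.
by rewrite fevalP p0 // q0 // scaler0 addr0.
Qed.

End Evaluation.

(** * Homogeneous signed elements and the multiplicity *)

Section GStarAlgebra.
Variables (F : fieldType) (gT : finGroupType) (A : gstar_algebra F gT).

Lemma homog0 g : homog g (0 : A).
Proof. by case: (homog_subspace A g). Qed.

Lemma homogZ g c (a : A) : homog g a -> homog g (c *: a).
Proof.
by case: (homog_subspace A g) => a0 aD ag; rewrite -[_ *: a]addr0; apply: aD.
Qed.

Lemma homogD g (a b : A) : homog g a -> homog g b -> homog g (a + b).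
Proof.
by case: (homog_subspace A g) => _ aD ag bg; rewrite -[a]scale1r; apply: aD.
Qed.

Lemma star1 : star (1 : A) = 1.
Proof. by rewrite -[LHS]mulr1 -{2}[1](starK (1 : A)) -starM mulr1 starK. Qed.

Lemma star0 : star (0 : A) = 0.
Proof.
have := star_linear (-1) (0 : A) 0; rewrite scaler0 addr0 => ->.
by rewrite scaleN1r addNr.
Qed.

Lemma starZ c (a : A) : star (c *: a) = c *: star a.
Proof. by rewrite -[c *: a]addr0 star_linear star0 addr0. Qed.

Lemma homog1 : homog 1%g (1 : A).
Proof.
have [f fh f1] := homog_total (1 : A).
(* The degree 1 component [f 1] of the unit is a right unit for homogeneous
   elements: compare components of degree [h] in [a = \sum_g a * f g]. *)
have fr h (a : A) : homog h a -> a * f 1%g = a.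
  move=> ah; pose d g := a * f (h^-1 * g)%g - (if g == h then a else 0).
  suff /(_ h) : forall g, d g = 0.
    by rewrite /d mulVg eqxx => /eqP; rewrite subr_eq0 => /eqP.
  apply: homog_direct => [g|].
    rewrite /d -scaleN1r; apply: homogD.
      by rewrite -{1}[g](mulKVg h); apply: homogM.
    by apply: homogZ; case: eqP => [->|_] //; apply: homog0.
  rewrite sumrB -big_mkcond big_pred1_eq -mulr_sumr.
  rewrite (reindex_inj (mulgI h)) /=.
  under eq_bigr do rewrite mulKg.
  by rewrite -f1 mulr1 subrr.
(* By [fr], right multiplication by [f 1] fixes each component of [1], hence [1] itself. *)
suff -> : 1 = f 1%g by [].
rewrite -[RHS]mul1r {2}f1 mulr_suml {1}f1.
by apply: eq_bigr => g _; rewrite (fr g).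
Qed.

Lemma homog_sgn0 g e : homog_sgn g e (0 : A).
Proof. by split; [apply: homog0 | rewrite star0 mulr0]. Qed.

Lemma homog_sgnZ g e c (a : A) : homog_sgn g e a -> homog_sgn g e (c *: a).
Proof.
by case=> ag ae; split; [apply: homogZ | rewrite starZ ae scalerAr].
Qed.

Lemma homog_sgnD g e (a b : A) :
  homog_sgn g e a -> homog_sgn g e b -> homog_sgn g e (a + b).
Proof.
case=> ag ae [bg be]; split; first exact: homogD.
by rewrite -[a]scale1r star_linear ae be mulrDr !scale1r.
Qed.

Lemma homog_sgn1 : homog_sgn 1%g false (1 : A).
Proof. by split; [exact: homog1 | rewrite star1 mul1r]. Qed.

Lemma Id_sharp_fvar i (s : gT) e :
  Id_sharp A (fvar F (i, s, e)) <-> forall a : A, homog_sgn s e a -> a = 0.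
Proof.
split=> [Ix a ah|A0 phi phiA]; last by rewrite feval_var; apply: A0.
pose phi (x : gvar gT) : A := if x == (i, s, e) then a else 0.
have /Ix : forall j g f, homog_sgn g f (phi (j, g, f)).
  move=> j g f; rewrite /phi; case: eqP => [[_ -> ->]|_] //.
  exact: homog_sgn0.
by rewrite feval_var /phi eqxx.
Qed.

Lemma Gamma1_fvar (s : gT) e : Gamma1 s e (fvar F (0%N, s, e)).
Proof.
by exists 1%N, (fun=> 1), (fun=> fvar F (0%N, s, e)); split=> //;
   rewrite big_ord1 scale1r.
Qed.

Lemma Gamma1P (s : gT) e p :
  Gamma1 s e p -> exists c, p = c *: fvar F (0%N, s, e).
Proof.
case=> k [c [x [xE ->]]]; exists (\sum_i c i); rewrite scaler_suml.
by apply: eq_bigr => i _; rewrite (xE i).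
Qed.

Lemma sub_Gamma1_Id (s : gT) e :
  Id_sharp A (fvar F (0%N, s, e)) -> (Gamma1 s e `<=` Id_sharp A)%classic.
Proof.
have [I0 ID] := Id_sharp_subspace A.
by move=> Ix p /Gamma1P[c ->]; rewrite -[_ *: _]addr0; apply: ID.
Qed.

Lemma rename_fvar0 (t : 'S_1) (s : gT) e :
  rename t (fvar F (0%N, s, e)) = fvar F (0%N, s, e).
Proof. by rewrite /rename feval_var /= insubT [t _]ord1. Qed.

(** The quotient is then a line with trivial action. This existence result keeps [mult1] from
    falling back to its default [0] when the variable is not an identity. *)
Lemma is_mult1_1 (s : gT) e :
  ~ Id_sharp A (fvar F (0%N, s, e)) -> is_mult1 A s e 1.
Proof.
move=> NIx; have [I0 ID] := Id_sharp_subspace A.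
have W0 : (Gamma1 s e `&` Id_sharp A)%classic 0.
  split=> //; exists 0%N, (fun=> 0), (fun=> fvar F (0%N, s, e)).
  by split=> //; rewrite big_ord0.
exists 1%N, (fun=> fvar F (0%N, s, e)), (MxRepresentation (mx_repr1 F _ 1)).
split=> [|t i|t]; last by rewrite mxtrace1 mulr1.
  split=> [_|c|p]; first exact: Gamma1_fvar.
    rewrite big_ord1 => -[_ Icx] i; rewrite ord1.
    apply: contrapT => /eqP c0; apply: NIx.
    rewrite -[fvar F _]scale1r -(mulVf c0) -scalerA -[_ *: _]addr0.
    exact: ID.
  by move=> /Gamma1P[c ->]; exists (fun=> c); rewrite big_ord1 subrr.
by rewrite rename_fvar0 big_ord1 mxE [i]ord1 eqxx scale1r subrr.
Qed.

(** The trace at the identity is both [d] and [m] in [F]; in characteristic zero, [m] vanishes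
    exactly when the quotient does. *)
Lemma is_mult1_eq0 (s : gT) e m : [pchar F] =i pred0 -> is_mult1 A s e m ->
  (m == 0%N) <-> Id_sharp A (fvar F (0%N, s, e)).
Proof.
move=> /pcharf0P F0 [d [b [rG [qb _ trG]]]].
have [bV _ bspan] := qb.
have dm : (d == 0%N) = (m == 0%N).
  by rewrite -!F0 -[m%:R]mulr1 -(trG 1%g) repr_mx1 mxtrace1.
rewrite -dm; split=> [d0 | Ix].
  have {bspan} [c [_]] := bspan _ (Gamma1_fvar s e).
  by move/eqP: d0 => d0; subst d; rewrite big_ord0 subr0.
have [//|d0] := eqVneq d 0%N.
have lt0d : (0 < d)%N by rewrite lt0n.
case: (quotient_basis_notin (i := Ordinal lt0d) qb).
by split; [exact: bV | exact/(sub_Gamma1_Id Ix)/bV].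
Qed.

Lemma mult1_neq0P (s : gT) e : [pchar F] =i pred0 ->
  mult1 A s e <> 0%N <-> exists2 a : A, homog_sgn s e a & a <> 0.
Proof.
move=> F0; have -> : (mult1 A s e <> 0%N) <->
    ~ Id_sharp A (fvar F (0%N, s, e)).
  rewrite /mult1; case: xgetP => [m _ mP|Nmult].
    split; apply: contra_not; first by move=> /(is_mult1_eq0 F0 mP)/eqP.
    by move=> /eqP/(is_mult1_eq0 F0 mP).
  (* If no multiplicity existed, the variable would be an identity, in agreement with the default
     [0]. *)
  by split=> // /is_mult1_1/Nmult.
split=> [NIx | [a ah aN0] /Id_sharp_fvar Ix]; last exact/aN0/Ix.
apply: contrapT => Na; apply: NIx; apply/Id_sharp_fvar => a ah.
by apply: contrapT => aN0; apply: Na; exists a.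
Qed.

End GStarAlgebra.

(** * Membership of [C_2] in the variety *)

Section C2Variety.
Variables (F : fieldType) (gT : finGroupType).

(** [C2_mk 0 1] is [e12], whose square is zero, so higher coefficients do not contribute. *)
Lemma horner_alg_C2 (q : {poly F}) : q`_0 = 0 -> q`_1 = 0 ->
  horner_alg (C2_mk 0 1) q = 0.
Proof.
move=> q0 q1; rewrite horner_alg_sum big1 // => -[[|[|i]] /= _] _.
- by rewrite q0 scale0r.
- by rewrite q1 scale0r.
by rewrite !exprS mulrA C2_mkM !mul0r mulr0 addr0 -C2_mk0 mul0r scaler0.
Qed.

(** A wrong degree kills a coordinate directly; a wrong sign forces [c = - c], hence [c = 0] since 2
    is invertible. *)
Lemma C2_homog_sgnP (s g : gT) (e f : bool) (a b : F) : [pchar F] =i pred0 ->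
  homog_sgn g f (C2_mk a b : C2_gstar F s e) ->
  ((g, f) != (1%g, false) -> a = 0) /\ ((g, f) != (s, e) -> b = 0).
Proof.
move=> /pcharf0P F0.
have opp0 (c : F) : c = - c -> c = 0.
  move=> /eqP; rewrite -subr_eq0 opprK -mulr2n -mulr_natr mulf_eq0 F0 orbF.
  by move/eqP.
case=> /C2_homogP[a0 b0] /=; rewrite C2_star_mk.
have -> : (-1) ^+ f * C2_mk a b = C2_mk ((-1) ^+ f * a) ((-1) ^+ f * b).
  by case: (f); rewrite ?mul1r // !mulN1r -scaleN1r C2_mkZ !mulN1r.
move=> /C2_mk_inj[aE bE]; rewrite !xpair_eqE !negb_and.
split=> /orP[gN|fN]; first exact: a0.
- by case: f fN aE {bE} => // _; rewrite mulN1r; exact: opp0.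
- exact: b0.
by case: e f fN bE {aE} => -[] // _; rewrite mulN1r mul1r => bE; exact: opp0.
Qed.

(** Treats both claims at once: [e = false] is the trivial involution, [e = true] the one negating
    [e12]. *)
Lemma var_sharp_C2P (A : gstar_algebra F gT) (s : gT) (e : bool) :
  [pchar F] =i pred0 -> (s, e) != (1%g, false) ->
  mult1 A s e <> 0%N <-> var_sharp A (C2_gstar F s e).
Proof.
move=> F0 seN; split=> [/(mult1_neq0P A s e F0)[a ah aN0] p Ip phi phiC | AC].
  pose psi x : {poly F} := (val (phi x) 0 0)%:P + (val (phi x) 0 1) *: 'X.
  have psiE (B : algType F) (b : B) x : horner_alg b (psi x) =
      (val (phi x) 0 0) *: 1 + (val (phi x) 0 1) *: b.
    rewrite /psi rmorphD -mul_polyC rmorphM /= !horner_algC horner_algX.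
    by rewrite mulr_algl.
  have phiE x : phi x = horner_alg (C2_mk 0 1) (psi x).
    rewrite psiE C2_mk1 !C2_mkZ C2_mkD !mulr0 !mulr1 addr0 add0r.
    by have [[c d] ->] := C2_mkP (phi x); rewrite C2_mk00 C2_mk01.
  have q0 : forall i, (feval psi p)`_i *: a ^+ i = 0.
    apply: horner_alg_scale_eq0 => // t.
    (* Admissibility: the scalar term survives only in degree 1 and sign +, where [1] lies, and the
       term in [t *: a] only in degree [s] and sign [e], where [a] lies. *)
    rewrite -feval_horner_alg; apply: Ip => i g f /=; rewrite psiE.
    have [[c d] /= cdE] := C2_mkP (phi (i, g, f)).
    have := phiC i g f; rewrite cdE C2_mk00 C2_mk01.
    move=> /(C2_homog_sgnP F0)[c0 d0]; apply: homog_sgnD.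
      have [[-> ->]|/c0 ->] := eqVneq (g, f) (1%g, false).
        exact/homog_sgnZ/homog_sgn1.
      by rewrite scale0r; apply: homog_sgn0.
    have [[-> ->]|/d0 ->] := eqVneq (g, f) (s, e).
      exact/homog_sgnZ/homog_sgnZ.
    by rewrite scale0r; apply: homog_sgn0.
  rewrite (eq_feval _ phiE) feval_horner_alg.
  (* Both [1] and [a] are nonzero, so [q0] at 0 and 1 gives the two coefficients. *)
  apply: horner_alg_C2.
    have /eqP := q0 0%N; rewrite expr0 scaler_eq0 oner_eq0 orbF.
    by move/eqP.
  have /eqP := q0 1%N; rewrite expr1 scaler_eq0 => /orP[/eqP // | /eqP].
  by move/aN0.
(* Conversely, if the component of [A] were zero, the variable would be an identity of [A], hence of
   [C_2], but [e12] is a nonzero value of it. *)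
apply/(mult1_neq0P A s e F0); apply: contrapT => Na.
have /AC/Id_sharp_fvar : Id_sharp A (fvar F (0%N, s, e)).
  apply/Id_sharp_fvar => a ah; apply: contrapT => aN0.
  by apply: Na; exists a.
move=> /(_ (C2_mk 0 1)); rewrite C2_mk0 => C0.
have /C0/C2_mk_inj[_ /eqP] : homog_sgn s e (C2_mk 0 1 : C2_gstar F s e).
  split; first by apply/C2_homogP; split=> //; rewrite eqxx.
  rewrite /= C2_star_mk mulr1; case: e {seN AC Na C0}; last by rewrite mul1r.
  by rewrite mulN1r -scaleN1r C2_mkZ mulr0 mulr1.
by rewrite oner_eq0.
Qed.

End C2Variety.

Theorem lemma4p1 (F : fieldType) (gT : finGroupType) (R : realType)
    (A : gstar_algebra F gT) :
  [pchar F] =i pred0 ->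
  quadratic_growth R A ->
  type_F_plus_J A ->
  (forall h : gT, h != 1%g ->
     mult1 A h false <> 0%N <-> var_sharp A (C2 F h)) /\
  (forall g : gT,
     mult1 A g true <> 0%N <-> var_sharp A (C2s F g)).
Proof.
move=> F0 _ _; split=> [h hN1|g]; apply: var_sharp_C2P => //.
  by rewrite xpair_eqE (negPf hN1).
by rewrite xpair_eqE andbF.
Qed.
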